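(* (1) Let $f:\mathbb{R}^n\times\mathbb{R}^m\to\mathbb{R}$ be twice continuously differentiable with $\nabla f$ Lipschitz with constant $L$. (1a) If $(\mathbf{x}^*,\mathbf{y}^* )$ is a local min-max critical point of $f$ and GDA is non-imaginary at $(\mathbf{x}^*,\mathbf{y}^* )$, then there is $\beta>0$ such that for all $0<\alpha<\beta$ the point $(\mathbf{x}^*,\mathbf{y}^* )$ is a GDA-stable fixed point for stepsize $\alpha$. (1b) If $(\mathbf{x}^*,\mathbf{y}^* )$ is a strongly local min-max critical point of $f$, then GDA is non-imaginary at $(\mathbf{x}^*,\mathbf{y}^* )$, and there is $\beta>0$ such that for all $0<\alpha<\beta$ the point $(\mathbf{x}^*,\mathbf{y}^* )$ is GDA-stable for stepsize $\alpha$. (1c) There exist a twice continuously differentiable function $f$ with $\nabla f$ Lipschitz with some constant $L$, and a critical point $(\mathbf{x}^*,\mathbf{y}^* )$ of $f$ at which GDA fails to be non-imaginary, such that $(\mathbf{x}^*,\mathbf{y}^* )$ is a local min-max point of $f$ but, for every $0<\alpha<\frac1L$, it is not GDA-stable for stepsize $\alpha$. (1d) There exist a twice continuously differentiable function $f$ with $\nabla f$ Lipschitz, and a critical point $(\mathbf{x}^*,\mathbf{y}^* )$ of $f$ that is not a local min-max point, such that for some $\beta>0$ and all $0<\alpha<\beta$ the point $(\mathbf{x}^*,\mathbf{y}^* )$ is GDA-stable for stepsize $\alpha$. (2) Let $f:\mathbb{R}^n\times\mathbb{R}^m\to\mathbb{R}$ be twice continuously differentiable with $\nabla f$ Lipschitz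 with constant $L$, and let $0<\alpha<\frac{1}{2L}$. If $(\mathbf{x}^*,\mathbf{y}^* )$ is a GDA-stable fixed point for stepsize $\alpha$, then $(\mathbf{x}^*,\mathbf{y}^* )$ is OGDA-stable for stepsize $\alpha$. Moreover, the inclusion is strict: there exist a twice continuously differentiable function $f$ with $\nabla f$ Lipschitz and a critical point $(\mathbf{x}^*,\mathbf{y}^* )$ of $f$ such that, for some $\beta>0$ and all $0<\alpha<\beta$, the point $(\mathbf{x}^*,\mathbf{y}^* )$ is OGDA-stable for stepsize $\alpha$ but not GDA-stable for stepsize $\alpha$.
   Context: For $f:\mathbb{R}^n\times\mathbb{R}^m\to\mathbb{R}$ and stepsize $\alpha>0$: GDA (Gradient Descent/Ascent) is the dynamical system on $\mathbb{R}^{n+m}$ with update rule $h(\mathbf{x},\mathbf{y})=(\mathbf{x}-\alpha\nabla_{\mathbf{x}}f(\mathbf{x},\mathbf{y}),\ \mathbf{y}+\alpha\nabla_{\mathbf{y}}f(\mathbf{x},\mathbf{y}))$. Its fixed points are exactly the critical points of $f$, i.e. points with $\nabla f(\mathbf{x},\mathbf{y})=\mathbf{0}$. OGDA (Optimistic Gradient Descent/Ascent) is the recursion $\mathbf{x}_{t+1}=\mathbf{x}_t-2\alpha\nabla_{\mathbf{x}}f(\mathbf{x}_t,\mathbf{y}_t)+\alpha\nabla_{\mathbf{x}}f(\mathbf{x}_{t-1},\mathbf{y}_{t-1})$, $\mathbf{y}_{t+1}=\mathbf{y}_t+2\alpha\nabla_{\mathbf{y}}f(\mathbf{x}_t,\mathbf{y}_t)-\alpha\nabla_{\mathbf{y}}f(\mathbf{x}_{t-1},\mathbf{y}_{t-1})$.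 It is viewed as a dynamical system on $\mathbb{R}^{2n+2m}$ with update rule $g(\mathbf{x},\mathbf{y},\mathbf{z},\mathbf{w})=(\mathbf{x}-2\alpha\nabla_{\mathbf{x}}f(\mathbf{x},\mathbf{y})+\alpha\nabla_{\mathbf{x}}f(\mathbf{z},\mathbf{w}),\ \mathbf{y}+2\alpha\nabla_{\mathbf{y}}f(\mathbf{x},\mathbf{y})-\alpha\nabla_{\mathbf{y}}f(\mathbf{z},\mathbf{w}),\ \mathbf{x},\ \mathbf{y})$, where $\nabla_{\mathbf{x}}f(\mathbf{z},\mathbf{w})$, $\nabla_{\mathbf{y}}f(\mathbf{z},\mathbf{w})$ denote the partial gradients of $f$ in its first and second block of variables evaluated at $(\mathbf{z},\mathbf{w})$. Its fixed points are the points $(\mathbf{x},\mathbf{y},\mathbf{x},\mathbf{y})$ with $\nabla f(\mathbf{x},\mathbf{y})=\mathbf{0}$, and such a fixed point is identified with $(\mathbf{x},\mathbf{y})$. A fixed point of a continuously differentiable update rule is (linearly) stable if the Jacobian of the update rule at that point has spectral radius at most $1$, and unstable otherwise. A critical point $(\mathbf{x}^*,\mathbf{y}^* )$ of $f$ is GDA-stable (resp. OGDA-stable) for stepsize $\alpha$ if $(\mathbf{x}^*,\mathbf{y}^* )$ (resp. $(\mathbf{x}^*,\mathbf{y}^*,\mathbf{x}^*,\mathbf{y}^* )$) is a stable fixed point of the GDA (resp. OGDA) update rule with stepsize $\alpha$. A critical point $(\mathbf{x}^*,\mathbf{y}^* )$ is a local min-max point if there is a neighborhood $U$ of it such that for all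 $(\mathbf{x},\mathbf{y})\in U$, $f(\mathbf{x}^*,\mathbf{y})\le f(\mathbf{x}^*,\mathbf{y}^* )\le f(\mathbf{x},\mathbf{y}^* )$. It is a strongly local min-max point if $\lambda_{\min}(\nabla^2_{\mathbf{x}\mathbf{x}}f(\mathbf{x}^*,\mathbf{y}^* ))>0$ and $\lambda_{\max}(\nabla^2_{\mathbf{y}\mathbf{y}}f(\mathbf{x}^*,\mathbf{y}^* ))<0$. GDA is non-imaginary at a critical point $(\mathbf{x}^*,\mathbf{y}^* )$ if the matrix $$H=\begin{pmatrix}-\nabla^2_{\mathbf{x}\mathbf{x}}f & -\nabla^2_{\mathbf{x}\mathbf{y}}f\\ \nabla^2_{\mathbf{y}\mathbf{x}}f & \nabla^2_{\mathbf{y}\mathbf{y}}f\end{pmatrix}$$ evaluated at $(\mathbf{x}^*,\mathbf{y}^* )$ has no (complex) eigenvalue with real part $0$. *)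

(* Defs.v *)
From HB Require Import structures.
From mathcomp Require Import all_boot all_order all_algebra.
From mathcomp Require Import all_classical all_reals all_analysis.
From mathcomp Require Import complex.

Set Implicit Arguments.
Unset Strict Implicit.
Unset Printing Implicit Defensive.

Import Order.TTheory GRing.Theory Num.Theory.
Import numFieldNormedType.Exports.

Local Open Scope classical_set_scope.
Local Open Scope ring_scope.

(* A point (x, y) of R^n x R^m is the row vector [row_mx x y] : 'rV_(n + m);
   its two blocks are recovered by [lsubmx] and [rsubmx].  The library uses row
   vectors, so that [jacobian g z] and [eigenvalue] are the transposes of the
   usual conventions; this does not affect spectra. *)

(* The library norm on 'rV_k is the sup norm, hence this definition. *)
Definition enorm (R : realType) (k : nat) (v : 'rV[R]_k) : R :=
  Num.sqrt (\sum_(i < k) v 0 i ^+ 2).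

Definition grad (R : realType) (k : nat) (f : 'rV[R]_k -> R) (z : 'rV[R]_k) :
    'rV[R]_k :=
  \row_(i < k) 'D_(delta_mx 0 i) f z.

(* Entry (i, j) is the derivative in direction i of the j-th partial
   derivative of f. *)
Definition hess (R : realType) (k : nat) (f : 'rV[R]_k -> R) (z : 'rV[R]_k) :
    'M[R]_k :=
  jacobian (grad f) z.

Definition twice_cont_diff (R : realType) (k : nat) (f : 'rV[R]_k -> R) : Prop :=
  [/\ forall z, differentiable f z,
      forall z, differentiable (grad f) z
    & continuous (hess f)].

Definition grad_lipschitz (R : realType) (k : nat) (L : R)
    (f : 'rV[R]_k -> R) : Prop :=
  forall u v : 'rV[R]_k, enorm (grad f u - grad f v) <= L * enorm (u - v).

Definition critical_point (R : realType) (k : nat) (f : 'rV[R]_k -> R)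
    (z : 'rV[R]_k) : Prop :=
  grad f z = 0.

Definition cspectrum (R : realType) (k : nat) (A : 'M[R]_k) : set R[i] :=
  [set l | eigenvalue (map_mx (real_complex R) A) l].

Definition spectral_radius (R : realType) (k : nat) (A : 'M[R]_k) : R :=
  sup [set ComplexField.Normc.normc l | l in cspectrum A].

(* Extreme real eigenvalues; only used for the (symmetric) diagonal blocks of a
   Hessian.  For k > 0 the spectrum of a symmetric matrix is finite and
   nonempty, so that inf and sup are a minimum and a maximum. *)
Definition lambda_min (R : realType) (k : nat) (A : 'M[R]_k) : R :=
  inf [set l : R | eigenvalue A l].

Definition lambda_max (R : realType) (k : nat) (A : 'M[R]_k) : R :=
  sup [set l : R | eigenvalue A l].

(* Meaningful for update rules h that are continuously differentiable. *)
Definition stable_fixed_point (R : realType) (k : nat)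
    (h : 'rV[R]_k -> 'rV[R]_k) (z : 'rV[R]_k) : Prop :=
  h z = z /\ spectral_radius (jacobian h z) <= 1.

Section MinMax.
Variables (R : realType) (n m : nat) (f : 'rV[R]_(n + m) -> R).

Definition grad_x (z : 'rV[R]_(n + m)) : 'rV[R]_n := lsubmx (grad f z).
Definition grad_y (z : 'rV[R]_(n + m)) : 'rV[R]_m := rsubmx (grad f z).

Definition hess_xx (z : 'rV[R]_(n + m)) : 'M[R]_n := ulsubmx (hess f z).
Definition hess_xy (z : 'rV[R]_(n + m)) : 'M[R]_(n, m) := ursubmx (hess f z).
Definition hess_yx (z : 'rV[R]_(n + m)) : 'M[R]_(m, n) := dlsubmx (hess f z).
Definition hess_yy (z : 'rV[R]_(n + m)) : 'M[R]_m := drsubmx (hess f z).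

Definition gda (alpha : R) (z : 'rV[R]_(n + m)) : 'rV[R]_(n + m) :=
  row_mx (lsubmx z - alpha *: grad_x z) (rsubmx z + alpha *: grad_y z).

(* The state is [row_mx p q] with p = (x, y) the current and q = (z, w) the
   previous iterate. *)
Definition ogda (alpha : R) (u : 'rV[R]_((n + m) + (n + m))) :
    'rV[R]_((n + m) + (n + m)) :=
  let p := lsubmx u in
  let q := rsubmx u in
  row_mx
    (row_mx
       (lsubmx p - (2 * alpha) *: grad_x p + alpha *: grad_x q)
       (rsubmx p + (2 * alpha) *: grad_y p - alpha *: grad_y q))
    p.

Definition gda_stable (alpha : R) (z : 'rV[R]_(n + m)) : Prop :=
  stable_fixed_point (gda alpha) z.

Definition ogda_stable (alpha : R) (z : 'rV[R]_(n + m)) : Prop :=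
  stable_fixed_point (ogda alpha) (row_mx z z).

Definition local_minmax (z : 'rV[R]_(n + m)) : Prop :=
  \forall u \near z,
    f (row_mx (lsubmx z) (rsubmx u)) <= f z /\
    f z <= f (row_mx (lsubmx u) (rsubmx z)).

Definition strongly_local_minmax (z : 'rV[R]_(n + m)) : Prop :=
  0 < lambda_min (hess_xx z) /\ lambda_max (hess_yy z) < 0.

Definition gda_matrix (z : 'rV[R]_(n + m)) : 'M[R]_(n + m) :=
  block_mx (- hess_xx z) (- hess_xy z) (hess_yx z) (hess_yy z).

Definition gda_non_imaginary (z : 'rV[R]_(n + m)) : Prop :=
  forall l : R[i], cspectrum (gda_matrix z) l -> complex.Re l <> 0.

End MinMax.

(* Main.v *)
(* With D = diag(-1, 1) and S the Hessian, the GDA Jacobian is 1 + alpha S D,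
   whose eigenvalues are 1 + alpha l with l an eigenvalue of H = D S.  Writing
   a complex eigenvector of H as a + i b, Re l (|a|^2 + |b|^2) = a H a^T + b H b^T,
   and the symmetry of S cancels the mixed blocks in these quadratic forms: the
   second-order conditions of a local min-max point give Re l <= 0, strong
   definiteness gives Re l < 0, and an eigenvalue with Re l < 0 satisfies
   |1 + alpha l| <= 1 for small alpha.

   Each eigenvalue mu != 1/2 of the OGDA Jacobian solves
   mu^2 - mu (1 + 2 alpha l) + alpha l = 0, and |l| <= L.  If Re l <= 0 (which
   GDA-stability implies) and alpha L < 1/2, then |mu| <= 1.

   The function x_0 y_0 has the eigenvalues +-i, so it is never GDA-stable, but
   OGDA-stable for small alpha; - x_0^2 / 2 + 2 x_0 y_0 - 3 y_0^2 / 2 has the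
   only non-zero eigenvalue -1, and is concave in x. *)

Require Import Defs.
From HB Require Import structures.
From mathcomp Require Import all_boot all_order all_algebra.
From mathcomp Require Import all_classical all_reals all_analysis.
From mathcomp Require Import complex.
From mathcomp Require Import ring lra.

Import Order.TTheory GRing.Theory Num.Theory.
Import numFieldNormedType.Exports.

Local Open Scope ring_scope.

(** * Complex spectra of real matrices *)

Section Spectrum.
Variables (R : realType) (k : nat).
Implicit Types (A : 'M[R]_k) (l : R[i]).

Lemma normc_sqr (l : R[i]) :
  ComplexField.Normc.normc l ^+ 2 = complex.Re l ^+ 2 + complex.Im l ^+ 2.
Proof. by case: l => p q /=; rewrite sqr_sqrtr// addr_ge0 ?sqr_ge0. Qed.

Lemma normc_le l (c : R) : 0 <= c ->
  (ComplexField.Normc.normc l <= c) =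
  (complex.Re l ^+ 2 + complex.Im l ^+ 2 <= c ^+ 2).
Proof.
move=> c0; rewrite -normc_sqr ler_sqr// nnegrE//.
by case: l => p q /=; exact: sqrtr_ge0.
Qed.

Lemma Re_mx_mul (v : 'rV[R[i]]_k) A :
  map_mx (@complex.Re R) (v *m map_mx (real_complex R) A)
  = map_mx (@complex.Re R) v *m A.
Proof.
apply/rowP=> j; rewrite !mxE raddf_sum; apply: eq_bigr => i _.
by rewrite !mxE; case: (v 0 i) => p q /=; rewrite mulr0 subr0.
Qed.

Lemma Im_mx_mul (v : 'rV[R[i]]_k) A :
  map_mx (@complex.Im R) (v *m map_mx (real_complex R) A)
  = map_mx (@complex.Im R) v *m A.
Proof.
apply/rowP=> j; rewrite !mxE raddf_sum; apply: eq_bigr => i _.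
by rewrite !mxE; case: (v 0 i) => p q /=; rewrite mulr0 add0r.
Qed.

Lemma complex_mx_eq (u v : 'rV[R[i]]_k) :
  map_mx (@complex.Re R) u = map_mx (@complex.Re R) v ->
  map_mx (@complex.Im R) u = map_mx (@complex.Im R) v -> u = v.
Proof.
move=> /rowP er /rowP ei; apply/rowP=> j.
move: (er j) (ei j); rewrite !mxE.
by case: (u 0 j) => a b; case: (v 0 j) => c d /= -> ->.
Qed.

(* [a] and [b] are the real and imaginary parts of a complex eigenvector. *)
Lemma cspectrumP A l :
  cspectrum A l <-> exists a b : 'rV[R]_k,
    [/\ a != 0 \/ b != 0,
        a *m A = complex.Re l *: a - complex.Im l *: b
      & b *m A = complex.Re l *: b + complex.Im l *: a].
Proof.
split.
  move=> /eigenvalueP[v vA v0].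
  exists (map_mx (@complex.Re R) v), (map_mx (@complex.Im R) v); split.
  - apply/orP; apply: contraNT v0; rewrite negb_or !negbK => /andP[/eqP a0 /eqP b0].
    by apply/eqP/complex_mx_eq; rewrite ?a0 ?b0; apply/rowP=> j; rewrite !mxE.
  - rewrite -Re_mx_mul vA; apply/rowP=> j; rewrite !mxE.
    by case: (l) (v 0 j) => ? ? [].
  - rewrite -Im_mx_mul vA; apply/rowP=> j; rewrite !mxE.
    by case: (l) (v 0 j) => ? ? [].
move=> [a [b [ab0 aA bA]]]; apply/eigenvalueP.
exists (\row_j (Complex (a 0 j) (b 0 j))).
  have Ra : map_mx (@complex.Re R) (\row_j (Complex (a 0 j) (b 0 j))) = a.
    by apply/rowP=> j; rewrite !mxE.
  have Rb : map_mx (@complex.Im R) (\row_j (Complex (a 0 j) (b 0 j))) = b.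
    by apply/rowP=> j; rewrite !mxE.
  apply: complex_mx_eq; rewrite ?Re_mx_mul ?Im_mx_mul ?Ra ?Rb ?aA ?bA;
    by apply/rowP=> j; rewrite !mxE; case: (l).
apply/eqP => /rowP v0.
suff [a0 b0] : a = 0 /\ b = 0 by move: ab0; rewrite a0 b0 eqxx; case.
by split; apply/rowP=> j; move: (v0 j); rewrite !mxE => -[].
Qed.

(** The characteristic polynomial splits over the algebraically closed field [R[i]]. Finiteness
    bounds the moduli under [sup] and later allows one stepsize bound for all eigenvalues. *)
Lemma cspectrum_finite A : exists s : seq R[i], forall l, cspectrum A l -> l \in s.
Proof.
have [s sE] := closed_field_poly_normal (char_poly (map_mx (real_complex R) A)).
exists s => l; rewrite /cspectrum /= eigenvalue_root_char sE.
by rewrite (monicP (char_poly_monic _)) scale1r root_prod_XsubC.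
Qed.

Lemma spectral_radius_le A (c : R) : 0 <= c ->
  spectral_radius A <= c <->
  forall l, cspectrum A l -> ComplexField.Normc.normc l <= c.
Proof.
move=> c0; split=> [Ac l Al|Ac].
  apply: le_trans Ac; apply: ub_le_sup; last by exists l.
  have [s As] := cspectrum_finite A.
  exists (\sum_(x <- s) ComplexField.Normc.normc x) => _ [x Ax <-].
  rewrite (big_rem x) ?As//= lerDl sumr_ge0// => i _.
  by case: i => p q /=; exact: sqrtr_ge0.
rewrite /spectral_radius; set S := (X in sup X).
(* On an empty spectrum, as for [k = 0], [sup] takes the value 0, and [0 <= c] concludes. *)
have [[x Sx]|/set0P/negP/negPn/eqP ->] := pselect (S !=set0)%classic; last by rewrite sup0.
by apply: ge_sup; [exists x|move=> _ [l Al <-]; exact: Ac].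
Qed.

End Spectrum.

(* An eigenvalue [w] of [alpha *: gda_matrix] gives rise to the roots [mu] of
   [mu^2 - mu (1 + 2 w) + w] as eigenvalues of the OGDA Jacobian.  If |mu| > 1,
   then |w| < 1/2 forces Re mu > (2 |mu|^2 + 1) / 4, and Re w > 0 follows from
   [Re w * |2 mu - 1|^2 = (2 Re mu - 1) (|mu|^2 - Re mu)]. *)
Lemma ogda_root_le1 (R : realType) (w mu : R[i]) :
  complex.Re w <= 0 -> ComplexField.Normc.normc w < 2^-1 ->
  w * (2 * mu - 1) = mu ^+ 2 - mu -> ComplexField.Normc.normc mu <= 1.
Proof.
move=> w0 w1; case: w w0 w1 => p q /= p0 w1.
have {}w1 : 4 * (p ^+ 2 + q ^+ 2) < 1.
  have := w1; rewrite -ltr_sqr ?nnegrE ?sqrtr_ge0 ?invr_ge0//.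
  rewrite sqr_sqrtr ?addr_ge0 ?sqr_ge0// => h.
  have : 4 * (p ^+ 2 + q ^+ 2) < 4 * 2^-1 ^+ 2 by rewrite ltr_pM2l.
  by move=> /lt_le_trans; apply; rewrite le_eqVlt; apply/orP; left; apply/eqP; field.
case: mu => a b; rewrite expr2.
rewrite (_ : 2 * _ - 1 = Complex (2 * a - 1) (2 * b)); last first.
  by rewrite mulr_natl mulr2n; congr Complex; ring.
move=> [].
rewrite normc_le// !/(complex.Re _) !/(complex.Im _) expr1n => E1 E2.
rewrite leNgt; apply/negP; set r := a ^+ 2 + b ^+ 2 => r1.
(* Squared moduli of both sides of the equation: [4 * r - 4 * a + 1] is |2 mu - 1|^2 and
   [r - 2 * a + 1] is |mu - 1|^2. *)
have X1 : (p ^+ 2 + q ^+ 2) * (4 * r - 4 * a + 1) = r * (r - 2 * a + 1).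
  transitivity ((p * (2 * a - 1) - q * (2 * b)) ^+ 2 +
                (p * (2 * b) + q * (2 * a - 1)) ^+ 2).
    by rewrite /r; ring.
  by rewrite E1 E2 /r; ring.
(* Real part of the equation multiplied by the conjugate of 2 mu - 1. *)
have X2 : p * (4 * r - 4 * a + 1) = (2 * a - 1) * (r - a).
  transitivity ((p * (2 * a - 1) - q * (2 * b)) * (2 * a - 1) +
                (p * (2 * b) + q * (2 * a - 1)) * (2 * b)).
    by rewrite /r; ring.
  by rewrite E1 E2 /r; ring.
have N : 0 < 4 * r - 4 * a + 1.
  have -> : 4 * r - 4 * a + 1 = (2 * a - 1) ^+ 2 + (2 * b) ^+ 2 by rewrite /r; ring.
  rewrite lt_neqAle addr_ge0 ?sqr_ge0// andbT eq_sym paddr_eq0 ?sqr_ge0// !sqrf_eq0.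
  by apply/negP => /andP[/eqP a1 /eqP b0]; move: r1; rewrite /r; nra.
have B : 4 * r * (r - 2 * a + 1) < 4 * r - 4 * a + 1 by nra.
(* [B] rearranges to (2 r - 1) (2 r + 1) < 4 a (2 r - 1), and 2 r - 1 > 0. *)
have a1 : 2 * r + 1 < 4 * a by nra.
have ar : a < r.
  have : a ^+ 2 <= r by rewrite /r lerDl sqr_ge0.
  nra.
have : 0 < (2 * a - 1) * (r - a) by nra.
by rewrite -X2 => h; nra.
Qed.

(** * Differentiation on row vectors *)

Section Differentiation.
Variables (R : realType).

Lemma differentiable_mulmxr (p q : nat) (A : 'M[R]_(p, q)) (z : 'rV[R]_p) :
  differentiable (fun v : 'rV[R]_p => v *m A) z.
Proof.
rewrite (_ : (fun _ => _) = \sum_(i < p) (fun v : 'rV[R]_p => v 0 i *: row i A)).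
  by apply: differentiable_sum => i; apply: differentiableZl;
    exact: differentiable_coord.
by rewrite funeqE => v; rewrite fct_sumE mulmx_sum_row.
Qed.

#[global] Instance is_diff_mulmxr (p q : nat) (A : 'M[R]_(p, q)) (z : 'rV[R]_p) :
  is_diff z (fun v : 'rV[R]_p => v *m A) (fun v => v *m A).
Proof.
apply: DiffDef; first exact: differentiable_mulmxr.
have := @diff_lin R _ _ (mulmxr A : {linear 'rV[R]_p -> 'rV[R]_q}) z; apply.
by move=> y; apply: differentiable_continuous; exact: differentiable_mulmxr.
Qed.

Lemma is_diff_jacobian (p q : nat) (g : 'rV[R]_p -> 'rV[R]_q) (z : 'rV[R]_p) :
  differentiable g z -> is_diff z g (fun v => v *m jacobian g z).
Proof.
move=> dg; apply: DiffDef => //; apply/funext => v.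
by rewrite -deriveEjacobian// deriveE.
Qed.

Lemma jacobian_eq (p q : nat) (g : 'rV[R]_p -> 'rV[R]_q) (z : 'rV[R]_p) A :
  is_diff z g (fun v => v *m A) -> jacobian g z = A.
Proof.
move=> dg; apply/row_matrixP => i; rewrite !rowE -deriveEjacobian.
  by rewrite deriveE// diff_val.
exact: ex_diff.
Qed.

(** The difference quotient of the restriction to the line at [t] is the one of [f] at [z + t *: v]
    along [v]. *)
Lemma is_derive_line {W : normedModType R} (k : nat) (f : 'rV[R]_k -> W)
    (z v : 'rV[R]_k) (t : R) :
  differentiable f (z + t *: v) ->
  is_derive t 1 (fun s : R => f (z + s *: v)) ('D_v f (z + t *: v)).
Proof.
move=> df; have E : (fun h : R => h^-1 *:
    (((fun s : R => f (z + s *: v)) \o shift t) (h *: 1) - f (z + t *: v))) =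
  (fun h : R => h^-1 *: ((f \o shift (z + t *: v)) (h *: v) - f (z + t *: v))).
  by apply/funext => h /=; rewrite scalerDl addrCA [h *: 1]mulr1.
have := diff_derivable (v := v) df => cdf.
by apply: DeriveDef; rewrite /derivable /derive /= E.
Qed.

Lemma derive_grad (k : nat) (f : 'rV[R]_k -> R) (z v : 'rV[R]_k) :
  differentiable f z -> 'D_v f z = (grad f z *m v^T) 0 0.
Proof.
move=> df; rewrite deriveE// {1}[v]row_sum_delta linear_sum mxE.
by apply: eq_bigr => i _; rewrite linearZ/= !mxE deriveE// mulrC.
Qed.

(** For differentiable [f] the inner function is the derivative of [f] along [u], so this is the
    second derivative along [u] and [v]. *)
Lemma derive_grad_dot (k : nat) (f : 'rV[R]_k -> R) (z u v : 'rV[R]_k) :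
  differentiable (grad f) z ->
  differentiable (fun w => (grad f w *m u^T) 0 0) z /\
  'D_v (fun w => (grad f w *m u^T) 0 0) z = (v *m hess f z *m u^T) 0 0.
Proof.
move=> dg; have ddot : differentiable (fun w => (grad f w *m u^T) 0 0) z.
  apply: (@differentiable_comp _ _ _ _ (fun w => grad f w *m u^T)
    (fun M : 'M[R]_(1, 1) => M 0 0)); last exact: differentiable_coord.
  exact: (@differentiable_comp _ _ _ _ (grad f) (fun w => w *m u^T)).
split=> //.
have dm : differentiable (fun w => grad f w *m u^T) z.
  exact: (@differentiable_comp _ _ _ _ (grad f) (fun w => w *m u^T)).
have := derive_mx (diff_derivable (v := v) dm).
move=> /matrixP/(_ 0 0); rewrite [RHS]mxE => <-.
have /is_diff_jacobian dg' := dg.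
have dgu : is_diff z (fun w => grad f w *m u^T) (fun v => v *m hess f z *m u^T).
  exact: (@is_diff_comp _ _ _ _ (grad f) (fun v => v *m hess f z)
    (fun w => w *m u^T) (fun w => w *m u^T)).
by rewrite deriveE// diff_val.
Qed.

End Differentiation.

(** * Jacobians of GDA and OGDA *)

Section UpdateRules.
Variables (R : realType) (n m : nat).
Implicit Types (f : 'rV[R]_(n + m) -> R) (z : 'rV[R]_(n + m)) (alpha : R).

(** The matrix D = diag(-1, 1): applied on the right of the gradient it gives the joint
    descent/ascent direction. *)
Definition flip_mx : 'M[R]_(n + m) := block_mx (- 1%:M) 0 0 1%:M.

Lemma mulmx_flip (v : 'rV[R]_(n + m)) :
  v *m flip_mx = row_mx (- lsubmx v) (rsubmx v).
Proof.
rewrite -{1}[v]hsubmxK mul_row_block !mulmx0 mulmxN !mulmx1.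
by rewrite add0r addr0.
Qed.

Lemma flip_mxK : flip_mx *m flip_mx = 1%:M.
Proof.
rewrite mulmx_block !mulmx0 !mul0mx mulmxN mulmx1 opprK mulmx1 !addr0 add0r.
by rewrite -scalar_mx_block.
Qed.

Lemma gda_matrixE f z : gda_matrix f z = flip_mx *m hess f z.
Proof.
rewrite -[in RHS](submxK (hess f z)) mulmx_block !mul0mx !mulNmx !mul1mx.
by rewrite !addr0 !add0r.
Qed.

Lemma gdaE f alpha : gda f alpha = fun z => z + alpha *: (grad f z *m flip_mx).
Proof.
apply/funext => z; rewrite mulmx_flip scale_row_mx -[X in X + _]hsubmxK.
by rewrite add_row_mx scalerN.
Qed.

Lemma is_diff_grad_flip f z : differentiable (grad f) z ->
  is_diff z (fun w => grad f w *m flip_mx) (fun v => v *m (hess f z *m flip_mx)).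
Proof.
move=> /is_diff_jacobian df.
rewrite (_ : (fun v => v *m _) = (mulmx^~ flip_mx) \o (mulmx^~ (hess f z))).
  exact: (@is_diff_comp _ _ _ _ (grad f) (mulmx^~ (hess f z)) (mulmx^~ flip_mx)
    (mulmx^~ flip_mx)).
by apply/funext => v /=; rewrite mulmxA.
Qed.

Lemma jacobian_gda f alpha z : differentiable (grad f) z ->
  jacobian (gda f alpha) z = 1%:M + alpha *: (hess f z *m flip_mx).
Proof.
move=> /is_diff_grad_flip df; apply: jacobian_eq; rewrite gdaE.
rewrite (_ : (fun v => v *m _) = id + alpha *: (mulmx^~ (hess f z *m flip_mx))).
  exact: (@is_diffD _ _ _ id (alpha *: (fun w => grad f w *m flip_mx))).
by apply/funext => v; rewrite mulmxDr mulmx1 -scalemxAr.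
Qed.

(** In this form the chain rule applies term by term: [col_mx 1%:M 0] selects the current iterate,
    [col_mx 0 1%:M] the previous one, and a factor [row_mx _ 0] writes into the first block. *)
Lemma ogdaE f alpha (u : 'rV[R]_((n + m) + (n + m))) :
  ogda f alpha u =
  u *m block_mx 1%:M 1%:M 0 0 +
  ((grad f (u *m col_mx 1%:M 0) *m flip_mx) *m row_mx ((2 * alpha)%:M) 0 +
   (grad f (u *m col_mx 0 1%:M) *m flip_mx) *m row_mx ((- alpha)%:M) 0).
Proof.
have -> : u *m col_mx 1%:M 0 = lsubmx u.
  by rewrite -{1}[u]hsubmxK mul_row_col mulmx1 mulmx0 addr0.
have -> : u *m col_mx 0 1%:M = rsubmx u.
  by rewrite -{1}[u]hsubmxK mul_row_col mulmx1 mulmx0 add0r.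
rewrite -[X in X *m block_mx _ _ _ _]hsubmxK mul_row_block !mul_mx_row !mulmx0 !mulmx1 !addr0.
rewrite !add_row_mx !addr0 !mul_mx_scalar !mulmx_flip.
rewrite -[X in row_mx (X + _) _]hsubmxK !scale_row_mx !add_row_mx /ogda.
congr (row_mx (row_mx _ _) _).
  by rewrite scalerN scaleNr scalerN opprK addrA.
by rewrite scaleNr addrA.
Qed.

Lemma jacobian_ogda f alpha z : differentiable (grad f) z ->
  let K := hess f z *m flip_mx in
  jacobian (ogda f alpha) (row_mx z z) =
  block_mx (1%:M + (2 * alpha) *: K) 1%:M (- alpha *: K) 0.
Proof.
move=> df K; apply: jacobian_eq; rewrite (funext (ogdaE f alpha)).
(* Both gradient terms have this shape. At [row_mx z z] each selector [P] returns [z], so both terms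
   share the Jacobian [K]. *)
have dP (P : 'M[R]_((n + m) + (n + m), n + m)) (Q : 'M[R]_(n + m, (n + m) + (n + m))) :
    row_mx z z *m P = z ->
    is_diff (row_mx z z) (fun u => grad f (u *m P) *m flip_mx *m Q)
      (fun v => v *m (P *m K *m Q)).
  move=> zP.
  have dg : is_diff (row_mx z z *m P) (fun w => grad f w *m flip_mx) (mulmx^~ K).
    by rewrite zP; apply: is_diff_grad_flip.
  have d1 : is_diff (row_mx z z) (fun u => grad f (u *m P) *m flip_mx)
      ((mulmx^~ K) \o (mulmx^~ P)).
    exact: (@is_diff_comp _ _ _ _ (mulmx^~ P) (mulmx^~ P)
      (fun w => grad f w *m flip_mx) (mulmx^~ K)).
  rewrite (_ : (fun v => v *m (P *m _ *m _)) = (mulmx^~ Q) \o ((mulmx^~ K) \o (mulmx^~ P))).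
    exact: (@is_diff_comp _ _ _ _ (fun u => grad f (u *m P) *m flip_mx)
      ((mulmx^~ K) \o (mulmx^~ P))
      (mulmx^~ Q) (mulmx^~ Q)).
  by apply/funext => v /=; rewrite !mulmxA.
have d1 := dP (col_mx 1%:M 0) (row_mx ((2 * alpha)%:M) 0).
have d2 := dP (col_mx 0 1%:M) (row_mx ((- alpha)%:M) 0).
rewrite !mul_row_col !mulmx0 !mulmx1 addr0 add0r in d1 d2.
have {}d1 := d1 erefl; have {}d2 := d2 erefl.
set J1 := _ *m row_mx ((2 * alpha)%:M) 0 in d1.
set J2 := _ *m row_mx ((- alpha)%:M) 0 in d2.
rewrite (_ : block_mx (_ + _) _ _ _ = block_mx 1%:M 1%:M 0 0 + (J1 + J2)).
  rewrite (_ : (fun v => v *m (_ + _)) = (mulmx^~ (block_mx 1%:M 1%:M 0 0)) +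
     ((mulmx^~ J1) + (mulmx^~ J2))); last first.
    by apply/funext => v; rewrite !mulmxDr.
  pose g P (Q : 'M[R]_(n + m, (n + m) + (n + m)))
    (u : 'rV[R]_((n + m) + (n + m))) := grad f (u *m P) *m flip_mx *m Q.
  have d12 := @is_diffD _ _ _ (g _ _) (g _ _) _ _ _ d1 d2.
  exact: (@is_diffD _ _ _ (mulmx^~ _) (g _ _ + g _ _) _ _ _
    (is_diff_mulmxr _ _ _ _ _) d12).
rewrite /J1 /J2 ![col_mx _ _ *m K]mul_col_mx !mul_col_row mul1mx !mul0mx !mulmx0 !add_block_mx.
by rewrite !mul_mx_scalar !addr0 !add0r.
Qed.

(* [flip_mx] conjugates [S *m flip_mx] into [flip_mx *m S]. *)
Lemma cspectrum_flip (S : 'M[R]_(n + m)) (l : R[i]) :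
  cspectrum (S *m flip_mx) l <-> cspectrum (flip_mx *m S) l.
Proof.
suff H (A : 'M[R]_(n + m)) :
    cspectrum A l -> cspectrum (flip_mx *m A *m flip_mx) l.
  split=> /H; first by rewrite !mulmxA -mulmxA flip_mxK mulmx1.
  by rewrite !mulmxA flip_mxK mul1mx.
move=> /cspectrumP[a [b [ab0 aA bA]]].
have flip_neq0 (v : 'rV[R]_(n + m)) : v != 0 -> v *m flip_mx != 0.
  apply: contraNneq => /(congr1 (mulmx^~ flip_mx)).
  by rewrite -mulmxA flip_mxK mulmx1 mul0mx => ->.
apply/cspectrumP; exists (a *m flip_mx), (b *m flip_mx); split.
- by case: ab0 => /flip_neq0; [left|right].
- rewrite !mulmxA -(mulmxA a) flip_mxK mulmx1 aA mulmxBl.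
  by rewrite -!scalemxAl.
- rewrite !mulmxA -(mulmxA b) flip_mxK mulmx1 bA mulmxDl.
  by rewrite -!scalemxAl.
Qed.

Lemma cspectrum_gda f alpha z (l : R[i]) : differentiable (grad f) z ->
  cspectrum (gda_matrix f z) l ->
  cspectrum (jacobian (gda f alpha) z) (1 + real_complex R alpha * l).
Proof.
move=> df; rewrite gda_matrixE (jacobian_gda _ _ _ df); move: (hess f z) => S.
move=> /(proj2 (cspectrum_flip _ _)).
rewrite /cspectrum /= => /eigenvalueP[v vK v0]; apply/eigenvalueP; exists v => //.
rewrite map_mxD map_mx1 map_mxZ mulmxDr mulmx1 -scalemxAr vK.
by rewrite scalerA scalerDl scale1r.
Qed.

Lemma gda_cspectrum f alpha z (mu : R[i]) : differentiable (grad f) z ->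
  alpha != 0 -> cspectrum (jacobian (gda f alpha) z) mu ->
  exists2 l, cspectrum (gda_matrix f z) l & mu = 1 + real_complex R alpha * l.
Proof.
move=> df a0; rewrite (jacobian_gda _ _ _ df) gda_matrixE.
move: (hess f z) => S /eigenvalueP[v vJ v0].
have ac0 : real_complex R alpha != 0 by rewrite fmorph_eq0.
exists ((real_complex R alpha)^-1 * (mu - 1)); last by rewrite mulVKf// addrC subrK.
apply/(proj1 (cspectrum_flip _ _))/eigenvalueP; exists v => //.
apply: (scalerI ac0); rewrite scalerA mulVKf// scalerBl scale1r -vJ.
by rewrite map_mxD map_mx1 map_mxZ mulmxDr mulmx1 -scalemxAr addrC addKr.
Qed.

(** The second block of the eigenvector equation gives v1 = mu v2. Substituted into the first, it
    gives alpha (2 mu - 1) v2 K = (mu^2 - mu) v2, so v2 is an eigenvector of K unless mu = 1/2. *)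
Lemma ogda_cspectrum f alpha z (mu : R[i]) : differentiable (grad f) z ->
  alpha != 0 -> cspectrum (jacobian (ogda f alpha) (row_mx z z)) mu ->
  2 * mu - 1 = 0 \/ exists2 l, cspectrum (gda_matrix f z) l &
    real_complex R alpha * l * (2 * mu - 1) = mu ^+ 2 - mu.
Proof.
move=> df a0; rewrite (jacobian_ogda _ _ _ df) gda_matrixE; move: (hess f z) => S.
set K := _ *m _ => /eigenvalueP[v]; rewrite -[v]hsubmxK.
set v1 := lsubmx v; set v2 := rsubmx v.
rewrite map_block_mx mul_row_block scale_row_mx map_mx1 map_mx0 mulmx0 mulmx1.
rewrite addr0 => /eq_row_mx[E1 E2] v0.
have {}v0 : v2 != 0.
  by apply: contraNneq v0 => v20; rewrite E2 v20 scaler0 row_mx0.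
have [->|mu0] := eqVneq (2 * mu - 1) 0; [by left|right].
have ac0 : real_complex R alpha != 0 by rewrite fmorph_eq0.
have acm0 : real_complex R alpha * (2 * mu - 1) != 0 by rewrite mulf_neq0.
exists ((real_complex R alpha * (2 * mu - 1))^-1 * (mu ^+ 2 - mu)); last first.
  by rewrite invfM; field; rewrite ac0 mu0.
apply/(proj1 (cspectrum_flip _ _))/eigenvalueP; exists v2 => //; rewrite -/K.
apply: (scalerI acm0); rewrite scalerA mulVKf//.
move: E1; rewrite E2 map_mxD map_mx1 !map_mxZ mulmxDr mulmx1 -!scalemxAr.
rewrite -!scalemxAl.
set w := v2 *m _ => E1.
have : mu ^+ 2 *: v2 = mu *: v2 + (real_complex R alpha * (2 * mu - 1)) *: w.
  rewrite expr2 -scalerA -E1 -addrA; congr (_ + _).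
  rewrite scalerA -scalerDl; congr (_ *: _).
  by rewrite rmorphM rmorphN rmorph_nat; ring.
by rewrite scalerBl => ->; rewrite addrAC subrr add0r.
Qed.

End UpdateRules.

(** * Second-order calculus *)

Section SecondOrder.
Local Open Scope classical_set_scope.
Local Open Scope ring_scope.
Variables (R : realType).

(** Here [psi] is the first derivative of [phi] and [c] the second at 0. If [c < 0], then [psi] is
    negative just to the right of 0, and the mean value theorem makes [phi] drop below [phi 0]
    there. *)
Lemma second_order_min (phi psi : R -> R) (c : R) :
  (forall t : R, is_derive t (1 : R) phi (psi t)) -> psi 0 = 0 ->
  is_derive (0 : R) (1 : R) psi c ->
  (\forall t \near (0 : R), phi 0 <= phi t) -> 0 <= c.
Proof.
move=> dphi psi0 dpsi min; rewrite leNgt; apply/negP => c0.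
have psi_lt0 : \forall h \near (dnbhs (0 : R)), h^-1 * psi h < 0.
  have : (h^-1 *: ((psi \o shift 0) (h *: 1) - psi 0)) @[h --> (dnbhs (0 : R))] --> c.
    have [dv <-] := dpsi; exact: dv.
  move=> /cvgr_lt /(_ _ c0); apply: filterS => h /=.
  by rewrite addr0 psi0 subr0 [h *: 1]mulr1.
have : \forall h \near (dnbhs (0 : R)), h^-1 * psi h < 0 /\ phi 0 <= phi h.
  by near=> h; split; near: h => //; exact: nbhs_dnbhs.
move=> /nbhs_ballP[e /= e0 He].
have s0 : 0 < e / 2 by rewrite divr_gt0.
have small h : 0 < h -> h <= e / 2 -> h^-1 * psi h < 0 /\ phi 0 <= phi h.
  move=> h0 he; apply: He; last by rewrite gt_eqF.
  rewrite -ball_normE/= sub0r normrN gtr0_norm// (le_lt_trans he)//.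
  by rewrite ltr_pdivrMr// ltr_pMr// ltr1n.
have [x] := MVT s0 (fun x _ => dphi x)
  (derivable_within_continuous (fun x _ => ex_derive (is_derive := dphi x))).
rewrite in_itv/= => /andP[x0 xs]; rewrite subr0 => phiE.
have [_] := small _ s0 (lexx _); rewrite -subr_ge0 phiE leNgt => /negP; apply.
have [+ _] := small _ x0 (ltW xs); rewrite pmulr_rlt0 ?invr_gt0// => psix.
by rewrite pmulr_llt0.
Unshelve. all: by end_near. Qed.

(** The mean value theorem is used twice: along [u] for the difference [p] of [f] on two parallel
    lines, then along [v] for the derivative [G] of [f] along [u]. *)
Lemma mixed_difference (k : nat) (f : 'rV[R]_k -> R) (z u v : 'rV[R]_k) (s : R) :
  twice_cont_diff f -> 0 < s ->
  exists t r : R, [/\ 0 < t < s, 0 < r < s &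
    f (z + s *: v + s *: u) - f (z + s *: u) - (f (z + s *: v) - f z) =
    (v *m hess f (z + t *: u + r *: v) *m u^T) 0 0 * s * s].
Proof.
move=> [df dg _] s0.
pose G (w : 'rV[R]_k) : R := (grad f w *m u^T) 0 0.
have dG w : differentiable G w by have [] := derive_grad_dot R k f w u v (dg w).
have dGE w : 'D_v G w = (v *m hess f w *m u^T) 0 0.
  by have [] := derive_grad_dot R k f w u v (dg w).
pose p := (fun t : R => f (z + s *: v + t *: u)) - (fun t : R => f (z + t *: u)).
have dp t : is_derive t (1 : R) p (G (z + s *: v + t *: u) - G (z + t *: u)).
  by rewrite /G -!derive_grad//; apply: is_deriveB; exact: is_derive_line.
have [t ts pE] := MVT s0 (fun x _ => dp x)
  (derivable_within_continuous (fun x _ => ex_derive (is_derive := dp x))).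
pose q := (fun r : R => G (z + t *: u + r *: v)).
have dq r : is_derive r (1 : R) q ((v *m hess f (z + t *: u + r *: v) *m u^T) 0 0).
  by rewrite -dGE; exact: is_derive_line.
have [r rs qE] := MVT s0 (fun x _ => dq x)
  (derivable_within_continuous (fun x _ => ex_derive (is_derive := dq x))).
exists t, r; split; [by move: ts; rewrite in_itv|by move: rs; rewrite in_itv|].
move: pE; rewrite subr0 /p !fctE !scale0r !addr0 => ->; congr (_ * s).
by move: qE; rewrite /q subr0 scale0r addr0 addrAC => <-; rewrite addrAC.
Qed.

(* Expanding the mixed second difference of [mixed_difference] along [u] then
   [v], or [v] then [u], gives the two mixed derivatives at nearby points. *)
Lemma hess_sym (k : nat) (f : 'rV[R]_k -> R) (z : 'rV[R]_k) :
  twice_cont_diff f -> (hess f z)^T = hess f z.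
Proof.
move=> df; have [_ _ ch] := df; apply/matrixP => i j; rewrite mxE.
apply/eqP; rewrite -subr_eq0 -normr_le0; apply/ler_addgt0Pr => e e0; rewrite add0r.
have e20 : 0 < e / 2 by rewrite divr_gt0.
have chij a b : \forall w \near z, `|hess f z a b - hess f w a b| < e / 2.
  have : {for z, continuous (fun w => hess f w a b)}.
    exact: (@continuous_comp _ _ _ (hess f) (fun M : 'M[R]_(k, k) => M a b) z (ch z)
      (@coord_continuous _ _ _ a b _)).
  by move=> /cvgrPdist_lt /(_ _ e20).
have : \forall w \near z, `|hess f z j i - hess f w j i| < e / 2 /\
    `|hess f z i j - hess f w i j| < e / 2.
  by near=> w; split; near: w; exact: chij.
move=> /nbhs_ballP[d /= d0 Hd].
pose u : 'rV[R]_k := delta_mx 0 i; pose v : 'rV[R]_k := delta_mx 0 j.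
have N0 : 0 < `|u| + `|v| + 1 by rewrite ltr_wpDl// addr_ge0.
(* The side [s] is small enough for the whole parallelogram spanned by [s *: u] and [s *: v] at [z]
   to lie in the ball. *)
have [s s0 sd] : exists2 s : R, 0 < s & s * (`|u| + `|v| + 1) < d.
  exists (d / 2 / (`|u| + `|v| + 1)); first by rewrite !divr_gt0.
  by rewrite divfK ?gt_eqF// ltr_pdivrMr// ltr_pMr// ltr1n.
have entry a b (M : 'M[R]_k) :
    ((delta_mx 0 a : 'rV[R]_k) *m M *m (delta_mx 0 b : 'rV[R]_k)^T) 0 0 = M a b.
  by rewrite trmx_delta -rowE -colE !mxE.
have inball t r : 0 < t < s -> 0 < r < s -> ball z d (z + t *: u + r *: v).
  move=> /andP[t0 ts] /andP[r0 rs].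
  rewrite -ball_normE/= -addrA opprD addNKr normrN.
  rewrite (le_lt_trans (ler_normD _ _))// !normrZ !gtr0_norm//.
  apply: le_lt_trans sd.
  rewrite mulrDr mulr1 ler_wpDr ?(ltW s0)// mulrDr.
  by rewrite lerD// ler_wpM2r// ltW.
have [c H1 H2] : exists2 c : R,
    `|hess f z j i - c| < e / 2 & `|hess f z i j - c| < e / 2.
  have [t [r [ts rs E1]]] := mixed_difference k f z u v s df s0.
  have [r' [t' [rs' ts' E2]]] := mixed_difference k f z v u s df s0.
  have E : hess f (z + t *: u + r *: v) j i = hess f (z + r' *: v + t' *: u) i j.
    rewrite (entry j i) in E1; rewrite (entry i j) in E2.
    have s2 : s * s != 0 by rewrite mulf_neq0 ?gt_eqF.
    apply: (mulIf s2); rewrite !mulrA -E1 -E2.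
    by rewrite (addrAC z); ring.
  have [H1 _] := Hd _ (inball _ _ ts rs).
  have [_ H2] := Hd (z + r' *: v + t' *: u) (eq_ind_r (ball z d)
    (inball _ _ ts' rs') (addrAC _ _ _)).
  exists (hess f (z + t *: u + r *: v) j i); first exact: H1.
  exact: (eq_ind_r (fun c => `|hess f z i j - c| < e / 2) H2 E).
apply: (le_trans (ler_distD c _ _)); rewrite (distrC c) [leRHS]splitr.
by apply: lerD; apply: ltW.
Unshelve. all: by end_near. Qed.

End SecondOrder.

(** * Definite symmetric matrices *)

Section Definite.
Local Open Scope sesquilinear_scope.
Variables (R : realType) (k : nat).

(** With zero imaginary part the equations for [a] and [b] decouple, and whichever of the two is
    non-zero is a real eigenvector. *)
Lemma complex_eigenvalue_real (A : 'M[R]_k) (p : R) :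
  cspectrum A (real_complex R p) -> eigenvalue A p.
Proof.
move=> /cspectrumP[a [b [ab0]]] /=; rewrite scale0r subr0 scale0r addr0 => aA bA.
by apply/eigenvalueP; case: ab0; [exists a|exists b].
Qed.

(** The spectral theorem over [R[i]] diagonalizes [A] by a unitary [P] with real diagonal [d]. In
    the coordinates [y] of [x] the form becomes the sum of the d_i |y_i|^2. *)
Lemma sym_posdef (A : 'M[R]_k) : A^T = A ->
  (forall l, eigenvalue A l -> 0 < l) ->
  forall x : 'rV[R]_k, x != 0 -> 0 < (x *m A *m x^T) 0 0.
Proof.
move=> Asym Apos x x0.
pose toC := real_complex R.
pose B := map_mx toC A.
have Breal : B \is a mxOver Num.real.
  by apply/mxOverP => i j; rewrite !mxE complex_real.
have Bsym : B \is symmetricmx.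
  by apply/is_hermitianmxP; rewrite expr0 scale1r map_mx_id// /B map_trmx Asym.
have Bherm := realsym_hermsym Bsym Breal.
have /mxOverP dreal := hermitian_spectral_diag_real Bherm.
have /orthomx_spectralP := hermitian_normalmx Bherm.
have Pu := spectral_unitarymx B.
move: dreal; set P := spectralmx B in Pu *; set d := spectral_diag B => dreal BE.
have Punit : P \in unitmx := unitarymx_unit Pu.
(* Row [i] of [P] is a complex eigenvector for the real number [d 0 i], which is therefore a real
   eigenvalue of [A]. *)
have dpos i : 0 < d 0 i.
  have /complex_realP[r dr] := dreal 0 i.
  rewrite dr ltcR; apply/Apos/complex_eigenvalue_real/eigenvalueP.
  exists (row i P).
    rewrite -/toC -/B -row_mul BE !mulmxA mulmxV// mul1mx mul_diag_mx.
    by apply/rowP => j; rewrite !mxE dr.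
  apply: contraTneq Punit => Pi0; rewrite unitmxE.
  by rewrite (expand_det_row _ i) big1 ?unitr0// => j _;
    move/rowP: Pi0 => /(_ j); rewrite !mxE => ->; rewrite mul0r.
rewrite -(ltcR 0) -/toC.
pose y := map_mx toC x *m P^t*.
have y0 : y != 0.
  apply: contraNneq x0 => y0; apply/eqP/rowP => j.
  have : map_mx toC x = 0.
    rewrite -[LHS]mulmx1 -(mulVmx Punit) (invmx_unitary Pu) mulmxA.
    by rewrite -/y y0 mul0mx.
  by move=> /rowP/(_ j); rewrite !mxE => -[].
have -> : toC ((x *m A *m x^T) 0 0) = \sum_i d 0 i * `|y 0 i| ^+ 2.
  have -> : toC ((x *m A *m x^T) 0 0) = (map_mx toC (x *m A *m x^T)) 0 0.
    by rewrite [RHS]mxE.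
  rewrite !map_mxM -/B BE (invmx_unitary Pu) !mulmxA -/y.
  have -> : y *m diag_mx d *m P *m map_mx toC x^T = y *m diag_mx d *m y^t*.
    rewrite -[_ *m P *m _]mulmxA; congr (_ *m _).
    rewrite /y trmx_mul map_mxM trmxCK.
    congr (_ *m _); apply/matrixP => i j; rewrite !mxE.
    by apply/esym/CrealP; rewrite complex_real.
  rewrite mxE; apply: eq_bigr => i _.
  by rewrite mul_mx_diag !mxE normCK; ring.
have [i yi0] : exists i, y 0 i != 0.
  apply/existsP; apply: contraNT y0 => /existsPn yi.
  by apply/eqP/rowP => i; rewrite [RHS]mxE; apply/eqP; move: (yi i); rewrite negbK.
rewrite (bigD1 i)//= ltr_pwDl ?sumr_ge0//.
  by rewrite mulr_gt0// exprn_gt0// normr_gt0.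
by move=> j _; rewrite mulr_ge0 ?(ltW (dpos j))// exprn_ge0.
Qed.

(* [inf] is 0 on a set that is empty or not bounded below, so that a positive
   [lambda_min] bounds every eigenvalue from below. *)
Lemma lambda_min_posdef (A : 'M[R]_k) : A^T = A -> 0 < lambda_min A ->
  forall x : 'rV[R]_k, x != 0 -> 0 < (x *m A *m x^T) 0 0.
Proof.
move=> Asym Apos; apply: sym_posdef => // l Al.
apply: (lt_le_trans Apos); apply: ge_inf => //.
have [//|/inf_out Sinf] := pselect (has_inf [set l : R | eigenvalue A l]%classic).
  by case.
by move: Apos; rewrite /lambda_min Sinf ltxx.
Qed.

Lemma lambda_max_negdef (A : 'M[R]_k) : A^T = A -> lambda_max A < 0 ->
  forall x : 'rV[R]_k, x != 0 -> (x *m A *m x^T) 0 0 < 0.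
Proof.
move=> Asym Aneg x x0.
suff : 0 < (x *m - A *m x^T) 0 0 by rewrite mulmxN mulNmx mxE oppr_gt0.
apply: sym_posdef => //; first by rewrite linearN/= Asym.
move=> l /eigenvalueP[v vA v0].
have {}vA : eigenvalue A (- l).
  by apply/eigenvalueP; exists v => //; rewrite scaleNr -vA mulmxN opprK.
rewrite -oppr_lt0; apply: (le_lt_trans _ Aneg); apply: ub_le_sup => //.
(* Without a supremum [sup] would be 0, against [lambda_max A < 0]. *)
have [[]//|/sup_out Ssup] := pselect (has_sup [set l : R | eigenvalue A l]%classic).
by move: Aneg; rewrite /lambda_max Ssup ltxx.
Qed.

End Definite.

(** * Bounds on eigenvalues *)

Section Bounds.
Variable R : realType.

Lemma enorm_sqr (k : nat) (v : 'rV[R]_k) : enorm v ^+ 2 = \sum_i v 0 i ^+ 2.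
Proof. by rewrite sqr_sqrtr// sumr_ge0// => i _; exact: sqr_ge0. Qed.

Lemma enorm_dot (k : nat) (v : 'rV[R]_k) : enorm v ^+ 2 = (v *m v^T) 0 0.
Proof. by rewrite enorm_sqr mxE; apply: eq_bigr => i _; rewrite mxE. Qed.

Lemma enorm_gt0 (k : nat) (v : 'rV[R]_k) : v != 0 -> 0 < enorm v.
Proof.
move=> v0; rewrite lt_neqAle sqrtr_ge0 andbT eq_sym.
apply: contraNneq v0 => /eqP; rewrite -sqrf_eq0 enorm_sqr.
rewrite psumr_eq0 => [/allP v0|i _]; last exact: sqr_ge0.
apply/eqP/rowP => i; rewrite mxE; apply/eqP; rewrite -sqrf_eq0.
exact: (implyP (v0 i (mem_index_enum i))).
Qed.

Lemma enormZ (k : nat) (c : R) (v : 'rV[R]_k) : enorm (c *: v) = `|c| * enorm v.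
Proof.
rewrite -sqrtr_sqr -sqrtrM ?sqr_ge0//; congr (Num.sqrt _).
by rewrite mulr_sumr; apply: eq_bigr => i _; rewrite mxE exprMn.
Qed.

Lemma continuous_enorm_sqr (k : nat) :
  continuous (fun v : 'rV[R]_k => enorm v ^+ 2).
Proof.
move=> v; apply: differentiable_continuous.
rewrite (_ : (fun _ => _) =
  \sum_(i < k) (fun v : 'rV[R]_k => v 0 i) ^+ 2).
  by apply: differentiable_sum => i; apply: differentiableX;
    exact: differentiable_coord.
by rewrite funeqE => w; rewrite fct_sumE enorm_sqr.
Qed.

(** [v *m hess f z] is the limit of difference quotients of the gradient along [v], each of norm at
    most [L * enorm v]. The limit is taken on squared norms, which are polynomial in the
    coordinates. *)
Lemma enorm_hess_le (k : nat) (f : 'rV[R]_k -> R) (L : R) (z v : 'rV[R]_k) :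
  differentiable (grad f) z -> 0 <= L -> grad_lipschitz L f ->
  enorm (v *m hess f z) <= L * enorm v.
Proof.
move=> dg L0 lip; rewrite -ler_sqr ?nnegrE ?mulr_ge0 ?sqrtr_ge0//.
have qv : ((fun h : R => h^-1 *: (grad f (h *: v + z) - grad f z)) @ dnbhs (0 : R)
    --> v *m hess f z)%classic.
  by rewrite /hess -deriveEjacobian//; exact: diff_derivable.
have qn := cvg_comp _ _ qv (@continuous_enorm_sqr k _).
have := limr_le (cvgP _ qn); rewrite (cvg_lim _ qn)//; apply.
near=> h; have h0 : h != 0 by near: h; exact: nbhs_dnbhs_neq.
rewrite /= ler_sqr ?nnegrE ?mulr_ge0 ?sqrtr_ge0// enormZ normfV.
rewrite ler_pdivrMl ?normr_gt0// mulrCA -enormZ.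
by rewrite (le_trans (lip _ _))// addrK.
Unshelve. all: by end_near. Qed.

(** For an eigenvector a + i b, |l|^2 (|a|^2 + |b|^2) = |a A|^2 + |b A|^2, so a bound on real
    vectors suffices. *)
Lemma cspectrum_le (k : nat) (A : 'M[R]_k) (L : R) (l : R[i]) : 0 <= L ->
  (forall v : 'rV[R]_k, enorm (v *m A) <= L * enorm v) ->
  cspectrum A l -> ComplexField.Normc.normc l <= L.
Proof.
move=> L0 AL /cspectrumP[a [b [ab0 aA bA]]]; rewrite normc_le//.
have N0 : 0 < enorm a ^+ 2 + enorm b ^+ 2.
  case: ab0 => /enorm_gt0 v0; first by rewrite ltr_pwDl ?exprn_gt0 ?sqr_ge0.
  by rewrite ltr_wpDl ?exprn_gt0 ?sqr_ge0.
rewrite -(ler_pM2r N0).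
have -> : (complex.Re l ^+ 2 + complex.Im l ^+ 2) * (enorm a ^+ 2 + enorm b ^+ 2)
    = enorm (a *m A) ^+ 2 + enorm (b *m A) ^+ 2.
  rewrite aA bA !enorm_sqr -!big_split/= mulr_sumr; apply: eq_bigr => i _.
  by rewrite !mxE; ring.
have sqAL v : enorm (v *m A) ^+ 2 <= L ^+ 2 * enorm v ^+ 2.
  by rewrite -exprMn ler_sqr ?nnegrE ?mulr_ge0 ?sqrtr_ge0.
by rewrite mulrDr lerD.
Qed.

Lemma cspectrum_Re (k : nat) (A : 'M[R]_k) (l : R[i]) : cspectrum A l ->
  exists a b : 'rV[R]_k, [/\ a != 0 \/ b != 0,
    0 < enorm a ^+ 2 + enorm b ^+ 2 &
    complex.Re l * (enorm a ^+ 2 + enorm b ^+ 2) =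
    (a *m A *m a^T) 0 0 + (b *m A *m b^T) 0 0].
Proof.
move=> /cspectrumP[a [b [ab0 aA bA]]]; exists a, b; split=> //.
  case: ab0 => /enorm_gt0 v0; first by rewrite ltr_pwDl ?exprn_gt0 ?sqr_ge0.
  by rewrite ltr_wpDl ?exprn_gt0 ?sqr_ge0.
(* The terms carrying [complex.Im l] are opposite multiples of this scalar product and cancel. *)
have ba : (b *m a^T) 0 0 = (a *m b^T) 0 0.
  by rewrite -[b *m a^T]trmxK trmx_mul trmxK mxE.
rewrite aA bA !enorm_dot mulmxBl mulmxDl -!scalemxAl !mxE -!/((_ *m _) 0 0).
move: ba; rewrite !mxE => ->; ring.
Qed.

Lemma cspectrum_Re_le0 (k : nat) (A : 'M[R]_k) (l : R[i]) :
  (forall x : 'rV[R]_k, (x *m A *m x^T) 0 0 <= 0) ->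
  cspectrum A l -> complex.Re l <= 0.
Proof.
move=> A0 /cspectrum_Re[a [b [_ N0 lE]]].
by rewrite -(ler_pM2r N0) mul0r lE -[leRHS]addr0 lerD.
Qed.

Lemma cspectrum_Re_lt0 (k : nat) (A : 'M[R]_k) (l : R[i]) :
  (forall x : 'rV[R]_k, x != 0 -> (x *m A *m x^T) 0 0 < 0) ->
  cspectrum A l -> complex.Re l < 0.
Proof.
move=> A0 /cspectrum_Re[a [b [ab0 N0 lE]]].
have A0' (x : 'rV[R]_k) : (x *m A *m x^T) 0 0 <= 0.
  by have [->|/A0/ltW//] := eqVneq x 0; rewrite !mul0mx mxE.
rewrite -(ltr_pM2r N0) mul0r lE -[ltRHS]addr0.
by case: ab0 => /A0 ?; [apply: ltr_leD|apply: ler_ltD].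
Qed.

(** |1 + alpha l|^2 = 1 + alpha (2 Re l + alpha |l|^2), which is at most 1 once 0 < alpha < -2 Re l
    / |l|^2. Induction over a finite list containing the spectrum takes the least of these
    thresholds. *)
Lemma small_step_contraction (k : nat) (A : 'M[R]_k) :
  (forall l, cspectrum A l -> complex.Re l < 0 \/ l = 0) ->
  exists2 beta : R, 0 < beta & forall alpha : R, 0 < alpha < beta ->
    forall l, cspectrum A l ->
      ComplexField.Normc.normc (1 + real_complex R alpha * l) <= 1.
Proof.
move=> Aneg; have [s As] := cspectrum_finite _ _ A.
suff [beta b0 Hb] : exists2 beta : R, 0 < beta &
    forall alpha : R, 0 < alpha < beta -> forall l, l \in s ->
      complex.Re l < 0 \/ l = 0 ->
      ComplexField.Normc.normc (1 + real_complex R alpha * l) <= 1.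
  by exists beta => // alpha /Hb {}Hb l Al; exact: (Hb l (As l Al) (Aneg l Al)).
elim: s {As} => [|l s [beta b0 IH]]; first by exists 1.
(* The list may contain numbers that are not eigenvalues. If Re l >= 0, the hypothesis on [l] leaves
   only [l = 0], which keeps the modulus at 1. *)
have [l0|lN0] := ltP (complex.Re l) 0; last first.
  exists beta => // alpha /IH{}IH x; rewrite inE => /predU1P[->|]; last exact: IH.
  case=> [l0|->]; first by move: lN0; rewrite leNgt l0.
  by rewrite mulr0 addr0 normc_le// expr0n addr0.
pose N := complex.Re l ^+ 2 + complex.Im l ^+ 2.
have N0 : 0 < N by rewrite ltr_pwDl ?sqr_ge0// lt_neqAle sqr_ge0 eq_sym sqrf_eq0 lt_eqF.
exists (Num.min beta (- 2 * complex.Re l / N)).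
  by rewrite lt_min b0/= divr_gt0//; lra.
move=> alpha; rewrite lt_min => /and3P[a0 ab aN] x.
rewrite inE => /predU1P[-> _|]; last by apply: IH; rewrite a0.
move: aN; rewrite ltr_pdivlMr// /N normc_le//.
case: (l) => p q /= aN; nra.
Qed.

End Bounds.

(** * Stability criteria *)

Lemma near_line (R : realType) (k : nat) (z v : 'rV[R]_k) (P : 'rV[R]_k -> Prop) :
  (\forall u \near z, P u) -> \forall t \near (0 : R), P (z + t *: v).
Proof.
move=> zP; have cl : {for 0, continuous (fun t : R => z + t *: v)}.
  apply: continuousD; first exact: cst_continuous.
  exact: scalel_continuous.
by apply: cl; rewrite scale0r addr0.
Qed.

Section Stability.
Variables (R : realType) (n m : nat).
Implicit Types (f : 'rV[R]_(n + m) -> R) (z : 'rV[R]_(n + m)) (alpha L : R).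

Lemma gda_stableP f alpha z : differentiable (grad f) z -> alpha != 0 ->
  critical_point f z ->
  gda_stable f alpha z <-> forall l, cspectrum (gda_matrix f z) l ->
    ComplexField.Normc.normc (1 + real_complex R alpha * l) <= 1.
Proof.
move=> df a0 cz; split.
  move=> [_ /(spectral_radius_le _ _ _ _ ler01) st] l Hl.
  by apply: st; exact: cspectrum_gda.
move=> st; split; first by rewrite gdaE cz mul0mx scaler0 addr0.
apply/(spectral_radius_le _ _ _ _ ler01) => mu.
by move=> /(gda_cspectrum _ _ _ _ _ _ _ df a0)[l Hl ->]; exact: st.
Qed.

(** [flip_mx] is orthogonal, so the norm bound for the Hessian passes to its product with
    [flip_mx]. *)
Lemma cspectrum_gda_matrix_le f L z (l : R[i]) : differentiable (grad f) z ->
  0 <= L -> grad_lipschitz L f -> cspectrum (gda_matrix f z) l ->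
  ComplexField.Normc.normc l <= L.
Proof.
move=> df L0 lip; rewrite gda_matrixE => /(proj2 (cspectrum_flip _ _ _ _ _)).
apply: cspectrum_le => // v; rewrite mulmxA.
have enorm_flip (w : 'rV[R]_(n + m)) : enorm (w *m flip_mx R n m) = enorm w.
  apply/eqP; rewrite -(@eqrXn2 _ 2) ?sqrtr_ge0// !enorm_dot trmx_mul mulmxA.
  rewrite -(mulmxA w) (_ : (flip_mx R n m)^T = flip_mx R n m) ?flip_mxK ?mulmx1//.
  by rewrite tr_block_mx linearN/= !trmx1 !trmx0.
by rewrite enorm_flip; exact: enorm_hess_le.
Qed.

(** Stability reads 2 alpha Re l + alpha^2 |l|^2 <= 0, which excludes Re l > 0. *)
Lemma gda_stable_Re_le0 f alpha z : differentiable (grad f) z -> 0 < alpha ->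
  critical_point f z -> gda_stable f alpha z ->
  forall l, cspectrum (gda_matrix f z) l -> complex.Re l <= 0.
Proof.
move=> df a0 cz /(proj1 (gda_stableP _ _ _ df (lt0r_neq0 a0) cz)) st l /st.
rewrite normc_le//; case: l => p q /=; nra.
Qed.

Lemma ogda_stable_of_Re_le0 f L alpha z : differentiable (grad f) z ->
  0 < L -> grad_lipschitz L f -> 0 < alpha < 1 / (2 * L) ->
  critical_point f z ->
  (forall l, cspectrum (gda_matrix f z) l -> complex.Re l <= 0) ->
  ogda_stable f alpha z.
Proof.
move=> df L0 lip /andP[a0 aL] cz Re0; split.
  rewrite /ogda /grad_x /grad_y row_mxKl row_mxKr cz.
  have l0 : lsubmx (0 : 'rV[R]_(n + m)) = 0 by exact: linear0.
  have r0 : rsubmx (0 : 'rV[R]_(n + m)) = 0 by exact: linear0.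
  rewrite l0 r0.
  by rewrite !scaler0 !subr0 !addr0 hsubmxK.
apply/(spectral_radius_le _ _ _ _ ler01) => mu.
move=> /(ogda_cspectrum _ _ _ _ _ _ _ df (lt0r_neq0 a0))[mu2|[l Hl E]].
  (* The exceptional eigenvalue mu = 1/2. *)
  rewrite normc_le//; move: mu2; case: mu => p q.
  rewrite (_ : 2 * _ - 1 = Complex (2 * p - 1) (2 * q)); last first.
    by rewrite mulr_natl mulr2n; congr Complex; ring.
  by move=> [] /= ? ?; nra.
apply: ogda_root_le1 E.
  by move: (Re0 _ Hl); case: (l) => p q /=; nra.
have := cspectrum_gda_matrix_le _ _ _ _ df (ltW L0) lip Hl.
rewrite ComplexField.Normc.normcM => lL.
have -> : ComplexField.Normc.normc (real_complex R alpha) = alpha.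
  by rewrite /= expr0n addr0 sqrtr_sqr gtr0_norm.
apply: (@le_lt_trans _ _ (alpha * L)); first by rewrite ler_pM2l.
by move: aL; rewrite -ltr_pdivlMr// div1r invfM mulrC.
Qed.

Lemma quad_gda_matrix f z (v : 'rV[R]_(n + m)) : (hess f z)^T = hess f z ->
  (v *m gda_matrix f z *m v^T) 0 0 =
  (rsubmx v *m hess_yy f z *m (rsubmx v)^T) 0 0 -
  (lsubmx v *m hess_xx f z *m (lsubmx v)^T) 0 0.
Proof.
move=> Hs; rewrite -{1 2}[v]hsubmxK /gda_matrix.
move: (lsubmx v) (rsubmx v) => x y.
have cross : (y *m hess_yx f z *m x^T) 0 0 = (x *m hess_xy f z *m y^T) 0 0.
  have -> : hess_yx f z = (hess_xy f z)^T.
    by rewrite /hess_yx /hess_xy trmx_ursub Hs.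
  rewrite -[RHS]trace_mx11 -mxtrace_tr !trmx_mul trace_mx11.
  by rewrite trmxK mulmxA.
rewrite tr_row_mx mul_row_block mul_row_col !mulmxN !mulmxDl !mulNmx.
have mxD (A B : 'M[R]_1) : (A + B) 0 0 = A 0 0 + B 0 0 by rewrite mxE.
have mxN (A : 'M[R]_1) : (- A) 0 0 = - A 0 0 by rewrite mxE.
by rewrite !mxD !mxN cross; ring.
Qed.

(** The second-order condition along the line through [z] in direction [row_mx x 0], on which [f]
    has a local minimum at [z]. *)
Lemma local_minmax_hess_xx f z (x : 'rV[R]_n) : twice_cont_diff f ->
  critical_point f z -> local_minmax f z ->
  0 <= (x *m hess_xx f z *m x^T) 0 0.
Proof.
move=> [df dg _] cz mm; pose v : 'rV[R]_(n + m) := row_mx x 0.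
have -> : (x *m hess_xx f z *m x^T) 0 0 = (v *m hess f z *m v^T) 0 0.
  rewrite /v tr_row_mx trmx0 -[hess f z]submxK mul_row_block !mul0mx mul_row_col.
  by rewrite mulmx0 !addr0.
have [dG dGE] := derive_grad_dot _ _ f z v v (dg z).
apply: (@second_order_min _ (fun t => f (z + t *: v))
  (fun t => (grad f (z + t *: v) *m v^T) 0 0)).
- by move=> t; rewrite -derive_grad//; exact: is_derive_line.
- by rewrite scale0r addr0 cz mul0mx mxE.
- have := @is_derive_line _ _ _ (fun w => (grad f w *m v^T) 0 0) z v 0.
  by rewrite scale0r addr0 dGE; apply.
apply: filterS (near_line _ _ z v _ mm) => t [_].
rewrite scale0r addr0 /v scale_row_mx scaler0 -[z in z + _]hsubmxK add_row_mx.
by rewrite row_mxKl addr0.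
Qed.

Lemma local_minmax_hess_yy f z (y : 'rV[R]_m) : twice_cont_diff f ->
  critical_point f z -> local_minmax f z ->
  (y *m hess_yy f z *m y^T) 0 0 <= 0.
Proof.
move=> [df dg _] cz mm; pose v : 'rV[R]_(n + m) := row_mx 0 y.
have -> : (y *m hess_yy f z *m y^T) 0 0 = (v *m hess f z *m v^T) 0 0.
  rewrite /v tr_row_mx trmx0 -[hess f z]submxK mul_row_block !mul0mx mul_row_col.
  by rewrite mulmx0 !add0r.
have [dG dGE] := derive_grad_dot _ _ f z v v (dg z).
(* In the y-block [z] is a local maximum, so the minimum criterion is applied to [- f]. *)
rewrite -oppr_ge0.
apply: (@second_order_min _ (fun t => - f (z + t *: v))
  (fun t => - (grad f (z + t *: v) *m v^T) 0 0)).
- move=> t; rewrite -derive_grad//; apply: is_deriveN; exact: is_derive_line.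
- by rewrite scale0r addr0 cz mul0mx mxE oppr0.
- apply: is_deriveN.
  have := @is_derive_line _ _ _ (fun w => (grad f w *m v^T) 0 0) z v 0.
  by rewrite scale0r addr0 dGE; apply.
apply: filterS (near_line _ _ z v _ mm) => t [+ _]; rewrite lerN2.
rewrite scale0r addr0 /v scale_row_mx scaler0 -[z in z + _]hsubmxK add_row_mx.
by rewrite row_mxKr addr0.
Qed.

End Stability.

(** * Quadratic examples *)

Section Quadratic.
Variables (R : realType).

(** The factor 1/2 makes a symmetric [Q] the Hessian itself. *)
Definition quadratic {k : nat} (Q : 'M[R]_k) (z : 'rV[R]_k) : R :=
  2^-1 * (z *m Q *m z^T) 0 0.

(** * Calculus of symmetric quadratic forms *)

Section Derivatives.
Variables (k : nat) (Q : 'M[R]_k).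
Hypothesis Qsym : Q^T = Q.

Lemma is_derive_coord_mulmx (p q : nat) (A : 'M[R]_(p, q)) (z v : 'rV[R]_p) i :
  is_derive z v (fun w => (w *m A) 0 i) ((v *m A) 0 i).
Proof.
have dA : derivable (fun w : 'rV[R]_p => w *m A) z v.
  by apply: diff_derivable; exact: differentiable_mulmxr.
apply: DeriveDef; first by have /derivable_mxP := dA; apply.
have /matrixP/(_ 0 i) := derive_mx dA; rewrite [RHS]mxE => <-.
by rewrite deriveE ?diff_val//; exact: differentiable_mulmxr.
Qed.

Lemma quadraticE : quadratic Q =
  2^-1 *: \sum_(i < k) ((fun w : 'rV[R]_k => (w *m Q) 0 i) * (fun w => w 0 i)).
Proof.
apply/funext => w; rewrite [RHS]/GRing.scale/= fct_sumE /quadratic mxE.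
by congr (_ * _); apply: eq_bigr => i _; rewrite [w^T _ _]mxE.
Qed.

Lemma differentiable_quadratic (z : 'rV[R]_k) : differentiable (quadratic Q) z.
Proof.
rewrite quadraticE; apply: differentiableZ; apply: differentiable_sum => i.
apply: differentiableM; last exact: differentiable_coord.
apply: (@differentiable_comp _ _ _ _ (fun w => w *m Q)
  (fun M : 'M[R]_(1, k) => M 0 i)); last exact: differentiable_coord.
exact: differentiable_mulmxr.
Qed.

Lemma derive_quadratic (z v : 'rV[R]_k) :
  'D_v (quadratic Q) z = (z *m Q *m v^T) 0 0.
Proof.
have coord i : is_derive z v (fun w : 'rV[R]_k => w 0 i) (v 0 i).
  rewrite (_ : (fun w => _) = (fun w : 'rV[R]_k => (w *m 1%:M) 0 i)).
    by rewrite -{2}[v]mulmx1; exact: is_derive_coord_mulmx.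
  by apply/funext => w; rewrite mulmx1.
have dQ i := @is_deriveM _ _ _ _ z v _ _
  (is_derive_coord_mulmx _ _ Q z v i) (coord i).
rewrite quadraticE.
have /@derive_val -> := @is_deriveZ _ _ _ _ 2^-1 z v _ (is_derive_sum dQ).
have vQz : (v *m Q *m z^T) 0 0 = (z *m Q *m v^T) 0 0.
  rewrite -[RHS]trace_mx11 -mxtrace_tr !trmx_mul trace_mx11.
  by rewrite trmxK Qsym mulmxA.
rewrite big_split/= /GRing.scale/=.
rewrite (_ : \sum_i (z *m Q) 0 i *: v 0 i = (z *m Q *m v^T) 0 0); last first.
  by rewrite mxE; apply: eq_bigr => i _; rewrite [v^T _ _]mxE.
rewrite (_ : \sum_i z 0 i *: (v *m Q) 0 i = (z *m Q *m v^T) 0 0); last first.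
  by rewrite -vQz mxE; apply: eq_bigr => i _; rewrite [z^T _ _]mxE /GRing.scale/= mulrC.
by field.
Qed.

Lemma grad_quadratic : grad (quadratic Q) = mulmx^~ Q.
Proof.
apply/funext => z; apply/rowP => i; rewrite mxE derive_quadratic.
by rewrite trmx_delta -colE mxE.
Qed.

Lemma hess_quadratic z : hess (quadratic Q) z = Q.
Proof. by apply: jacobian_eq; rewrite grad_quadratic; exact: is_diff_mulmxr. Qed.

Lemma twice_cont_diff_quadratic : twice_cont_diff (quadratic Q).
Proof.
split; first exact: differentiable_quadratic.
  by move=> z; rewrite grad_quadratic; exact: differentiable_mulmxr.
rewrite (_ : hess _ = fun=> Q); first exact: cst_continuous.
by apply/funext => z; rewrite hess_quadratic.
Qed.

Lemma critical_point_quadratic : critical_point (quadratic Q) 0.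
Proof. by rewrite /critical_point grad_quadratic mul0mx. Qed.

Lemma grad_lipschitz_quadratic :
  exists2 L : R, 0 < L & grad_lipschitz L (quadratic Q).
Proof.
pose M j := \sum_i `|Q i j|.
have M0 j : 0 <= M j by rewrite sumr_ge0.
(* Entry [j] of [w *m Q] is at most [M j * enorm w], and the sum of the squares [M j ^+ 2] is at
   most the square of the sum. The summand 1 keeps the constant positive when [Q = 0]. *)
exists (\sum_j M j + 1); first by rewrite ltr_wpDl// sumr_ge0.
move=> u v; rewrite grad_quadratic -mulmxBl; move: (u - v) => {u v} w.
apply: (@le_trans _ _ ((\sum_j M j) * enorm w)); last first.
  by rewrite ler_wpM2r ?sqrtr_ge0// lerDl.
rewrite -ler_sqr ?nnegrE ?mulr_ge0 ?sqrtr_ge0 ?sumr_ge0//.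
rewrite exprMn enorm_sqr [(\sum_j M j) ^+ 2]expr2 mulr_suml mulr_suml.
apply: ler_sum => j _.
have wQ : `|(w *m Q) 0 j| <= M j * enorm w.
  rewrite mxE (le_trans (ler_norm_sum _ _ _))// /M mulr_suml.
  apply: ler_sum => i _; rewrite normrM mulrC ler_wpM2l//.
  rewrite -ler_sqr ?nnegrE ?sqrtr_ge0// real_normK ?num_real// enorm_sqr.
  by rewrite (bigD1 i)//= lerDl sumr_ge0// => l _; exact: sqr_ge0.
rewrite -real_normK ?num_real//.
apply: (@le_trans _ _ ((M j * enorm w) ^+ 2)).
  by rewrite ler_sqr ?nnegrE ?mulr_ge0 ?sqrtr_ge0.
rewrite exprMn ler_wpM2r ?sqr_ge0// expr2 ler_wpM2l//.
by rewrite (bigD1 j)//= lerDl sumr_ge0.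
Qed.

End Derivatives.

(** * Forms in the two coordinates x_0 and y_0 *)

Section Plane.
Variables (n m : nat).
Implicit Types p q r : R.

(* The quadratic form p x_0^2 / 2 + q x_0 y_0 + r y_0^2 / 2, where x_0 and y_0
   are the first coordinates of the two blocks. *)
Definition plane_mx p q r : 'M[R]_(n.+1 + m.+1) :=
  block_mx (p *: delta_mx 0 0) (q *: delta_mx 0 0)
           (q *: delta_mx 0 0) (r *: delta_mx 0 0).

Lemma tr_plane_mx p q r : (plane_mx p q r)^T = plane_mx p q r.
Proof. by rewrite tr_block_mx !linearZ/= !trmx_delta. Qed.

Lemma gda_matrix_plane p q r z :
  gda_matrix (quadratic (plane_mx p q r)) z =
  block_mx (- (p *: delta_mx 0 0)) (- (q *: delta_mx 0 0))
           (q *: delta_mx 0 0) (r *: delta_mx 0 0).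
Proof.
rewrite /gda_matrix /hess_xx /hess_xy /hess_yx /hess_yy.
rewrite hess_quadratic ?tr_plane_mx//.
by rewrite block_mxKul block_mxKur block_mxKdl block_mxKdr.
Qed.

Lemma mulmx_delta (S : comNzRingType) (a b : nat) (v : 'rV[S]_a) i (j : 'I_b) :
  v *m delta_mx i j = v 0 i *: delta_mx 0 j.
Proof.
apply/rowP => l; rewrite !mxE (bigD1 i)//= !mxE eqxx/= big1 ?addr0// => t ti.
by rewrite !mxE (negPf ti) mulr0.
Qed.

(** The image of a vector depends only on its coordinates x_0 and y_0. For [l != 0] these cannot
    both vanish on an eigenvector, which leaves a 2 x 2 eigenvalue problem. *)
Lemma cspectrum_plane p q r z (l : R[i]) :
  cspectrum (gda_matrix (quadratic (plane_mx p q r)) z) l ->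
  l = 0 \/ exists x y : R[i], [/\ x != 0 \/ y != 0,
    real_complex R q * y - real_complex R p * x = l * x &
    real_complex R r * y - real_complex R q * x = l * y].
Proof.
rewrite gda_matrix_plane => /eigenvalueP[v vH v0].
have [->|l0] := eqVneq l 0; [by left|right].
exists (lsubmx v 0 0), (rsubmx v 0 0).
move: vH v0; rewrite -[v]hsubmxK row_mxKl row_mxKr.
move: (lsubmx v) (rsubmx v) => x y.
rewrite map_block_mx !map_mxN !map_mxZ !map_delta_mx mul_row_block scale_row_mx.
rewrite !mulmxN -!scalemxAr !mulmx_delta => /eq_row_mx[Ex Ey] xy0.
split.
- apply/orP; apply: contraNT xy0; rewrite negb_or !negbK => /andP[/eqP x0 /eqP y0].
  move: Ex Ey; rewrite x0 y0 !(scaler0, scale0r, oppr0, addr0) => /esym Ex /esym Ey.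
  move/eqP: Ex; rewrite scaler_eq0 (negPf l0)/= => /eqP ->.
  by move/eqP: Ey; rewrite scaler_eq0 (negPf l0)/= => /eqP ->; rewrite row_mx0.
- by move/rowP: Ex => /(_ 0); rewrite !mxE !eqxx !mulr1 addrC.
- by move/rowP: Ey => /(_ 0); rewrite !mxE !eqxx !mulr1 addrC.
Qed.

Lemma saddle_eigenvalue z :
  cspectrum (gda_matrix (quadratic (plane_mx 0 1 0)) z) 'i%C.
Proof.
rewrite gda_matrix_plane !scale0r !scale1r oppr0; apply/cspectrumP.
(* On these two unit vectors the matrix acts as a quarter turn: the first goes to minus the second,
   the second to the first. *)
exists (row_mx (delta_mx 0 0) 0), (row_mx 0 (delta_mx 0 0)); split.
- left; apply/eqP => /(congr1 lsubmx); rewrite row_mxKl => /rowP/(_ 0).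
  by rewrite !mxE !eqxx => /eqP; rewrite oner_eq0.
- rewrite mul_row_block !mul0mx !mulmx0 !addr0 mulmxN mul_delta_mx.
  by rewrite /= scale0r scale1r add0r opp_row_mx oppr0.
- rewrite mul_row_block !mul0mx !mulmx0 !addr0 !add0r mul_delta_mx.
  by rewrite /= scale0r scale1r add0r.
Qed.

Lemma saddle_Re_le0 z (l : R[i]) :
  cspectrum (gda_matrix (quadratic (plane_mx 0 1 0)) z) l -> complex.Re l <= 0.
Proof.
apply: cspectrum_Re_le0 => x.
rewrite quad_gda_matrix; last by rewrite hess_quadratic ?tr_plane_mx.
rewrite /hess_xx /hess_yy hess_quadratic ?tr_plane_mx// block_mxKul block_mxKdr.
by rewrite !scale0r !mulmx0 !mul0mx !mxE subrr.
Qed.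

(** The eigenvalue i gives |1 + alpha i|^2 = 1 + alpha^2 > 1. *)
Lemma saddle_not_gda_stable alpha : alpha != 0 ->
  ~ gda_stable (quadratic (plane_mx 0 1 0)) alpha 0.
Proof.
have Qs := tr_plane_mx 0 1 0; have [_ dg _] := twice_cont_diff_quadratic _ _ Qs.
move=> a0 /(proj1 (gda_stableP _ _ _ _ _ _ (dg _) a0
  (critical_point_quadratic _ _ Qs))) /(_ _ (saddle_eigenvalue _)).
rewrite normc_le//= => st; have : 0 < alpha ^+ 2 by rewrite exprn_even_gt0.
by move: st; nra.
Qed.

(** The form x_0 y_0 vanishes when either block is 0, so both inequalities are equalities. *)
Lemma saddle_local_minmax : local_minmax (quadratic (plane_mx 0 1 0)) 0.
Proof.
rewrite /local_minmax; near=> u; rewrite /quadratic mul0mx mul0mx.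
have l0 : lsubmx (0 : 'rV[R]_(n.+1 + m.+1)) = 0 by exact: linear0.
have r0 : rsubmx (0 : 'rV[R]_(n.+1 + m.+1)) = 0 by exact: linear0.
rewrite l0 r0 !mul_row_block !scale0r !mulmx0 !mul0mx !addr0 !add0r.
by rewrite !tr_row_mx !mul_row_col !trmx0 !mulmx0 !mul0mx !addr0.
Unshelve. all: by end_near. Qed.

End Plane.

End Quadratic.

Theorem theorem1p10 (R : realType) (n m : nat)
    (n_gt0 : (0 < n)%N) (m_gt0 : (0 < m)%N) :
  [/\
    forall (f : 'rV[R]_(n + m) -> R) (L : R) (z : 'rV[R]_(n + m)),
      twice_cont_diff f -> 0 < L -> grad_lipschitz L f ->
      critical_point f z -> local_minmax f z -> gda_non_imaginary f z ->
      exists2 beta : R, 0 < beta &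
        forall alpha : R, 0 < alpha < beta -> gda_stable f alpha z,
    forall (f : 'rV[R]_(n + m) -> R) (L : R) (z : 'rV[R]_(n + m)),
      twice_cont_diff f -> 0 < L -> grad_lipschitz L f ->
      critical_point f z -> strongly_local_minmax f z ->
      gda_non_imaginary f z /\
      exists2 beta : R, 0 < beta &
        forall alpha : R, 0 < alpha < beta -> gda_stable f alpha z,
    exists (f : 'rV[R]_(n + m) -> R) (L : R) (z : 'rV[R]_(n + m)),
      [/\ twice_cont_diff f, 0 < L & grad_lipschitz L f] /\
      [/\ critical_point f z, ~ gda_non_imaginary f z, local_minmax f z
        & forall alpha : R, 0 < alpha < 1 / L -> ~ gda_stable f alpha z],
    exists (f : 'rV[R]_(n + m) -> R) (L : R) (z : 'rV[R]_(n + m)),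
      [/\ twice_cont_diff f, 0 < L & grad_lipschitz L f] /\
      [/\ critical_point f z, ~ local_minmax f z
        & exists2 beta : R, 0 < beta &
            forall alpha : R, 0 < alpha < beta -> gda_stable f alpha z]
    &
    (forall (f : 'rV[R]_(n + m) -> R) (L alpha : R) (z : 'rV[R]_(n + m)),
      twice_cont_diff f -> 0 < L -> grad_lipschitz L f ->
      0 < alpha < 1 / (2 * L) ->
      gda_stable f alpha z -> ogda_stable f alpha z) /\
    (exists (f : 'rV[R]_(n + m) -> R) (L : R) (z : 'rV[R]_(n + m)),
      [/\ twice_cont_diff f, 0 < L & grad_lipschitz L f] /\
      critical_point f z /\
      exists2 beta : R, 0 < beta &
        forall alpha : R, 0 < alpha < beta ->
          ogda_stable f alpha z /\ ~ gda_stable f alpha z)].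
Proof.
split.
- move=> f L z f2 L0 lip cz mm ni; have [_ dg _] := f2.
  have Hs := hess_sym _ _ _ z f2.
  have Re0 (l : R[i]) : cspectrum (gda_matrix f z) l -> complex.Re l <= 0.
    apply: cspectrum_Re_le0 => v; rewrite quad_gda_matrix// subr_le0.
    apply: (@le_trans _ _ 0); first exact: local_minmax_hess_yy.
    exact: local_minmax_hess_xx.
  (* Non-imaginarity makes Re l <= 0 strict. *)
  have [l lH|beta b0 Hb] := small_step_contraction _ _ (gda_matrix f z).
    by left; rewrite lt_neqAle Re0// andbT; apply/eqP; exact: ni.
  exists beta => // alpha /[dup] /andP[a0 _] /Hb st.
  by apply/(gda_stableP _ _ _ _ _ _ (dg z) (lt0r_neq0 a0) cz).
- move=> f L z f2 L0 lip cz [xx yy]; have [_ dg _] := f2.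
  have Hs := hess_sym _ _ _ z f2.
  have xxs : (hess_xx f z)^T = hess_xx f z by rewrite /hess_xx trmx_ulsub Hs.
  have yys : (hess_yy f z)^T = hess_yy f z by rewrite /hess_yy trmx_drsub Hs.
  have Re0 (l : R[i]) : cspectrum (gda_matrix f z) l -> complex.Re l < 0.
    apply: cspectrum_Re_lt0 => v v0; rewrite quad_gda_matrix// subr_lt0.
    have posx x := lambda_min_posdef _ _ _ xxs xx x.
    have negy y := lambda_max_negdef _ _ _ yys yy y.
    (* Some block of [v] is non-zero and gives the strict inequality; the other contributes with the
       right sign or not at all. *)
    have [x0|/posx xpos] := eqVneq (lsubmx v) 0; last first.
      apply: le_lt_trans xpos.
      by have [->|/negy/ltW//] := eqVneq (rsubmx v) 0; rewrite !mul0mx mxE.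
    rewrite x0 !mul0mx [ltRHS]mxE; apply: negy.
    by apply: contraNneq v0 => y0; rewrite -[v]hsubmxK x0 y0 row_mx0.
  split; first by move=> l /Re0 /ltr0_neq0 /eqP.
  have [l lH|beta b0 Hb] := small_step_contraction _ _ (gda_matrix f z).
    by left; exact: Re0.
  exists beta => // alpha /[dup] /andP[a0 _] /Hb st.
  by apply/(gda_stableP _ _ _ _ _ _ (dg z) (lt0r_neq0 a0) cz).
- case: n n_gt0 => // n' _; case: m m_gt0 => // m' _.
  have Qs := tr_plane_mx R n' m' 0 1 0.
  have [L L0 lip] := grad_lipschitz_quadratic _ _ _ Qs.
  exists (quadratic _ (plane_mx R n' m' 0 1 0)), L, 0; split.
    by split=> //; exact: twice_cont_diff_quadratic.
  split.
  + exact: critical_point_quadratic.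
  + by move=> /(_ _ (saddle_eigenvalue _ _ _ _)).
  + exact: saddle_local_minmax.
  + by move=> alpha /andP[a0 _]; apply: saddle_not_gda_stable; rewrite gt_eqF.
- case: n n_gt0 => // n' _; case: m m_gt0 => // m' _.
  have Qs := tr_plane_mx R n' m' (-1) 2 (-3).
  have f2 := twice_cont_diff_quadratic _ _ _ Qs; have [_ dg _] := f2.
  have cz := critical_point_quadratic _ _ _ Qs.
  have [L L0 lip] := grad_lipschitz_quadratic _ _ _ Qs.
  exists (quadratic _ (plane_mx R n' m' (-1) 2 (-3))), L, 0; split=> //; split=> //.
    (* The second-order condition fails along x_0, where the second derivative is -1. *)
    move=> /(local_minmax_hess_xx _ _ _ _ _ (delta_mx 0 0) f2 cz).
    rewrite /hess_xx hess_quadratic// block_mxKul -scalemxAr mul_delta_mx.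
    rewrite trmx_delta -scalemxAl mul_delta_mx !mxE !eqxx mulr1.
    by rewrite oppr_ge0 ler10.
  have [l|beta b0 Hb] :=
      small_step_contraction _ _ (gda_matrix (quadratic _ (plane_mx R n' m' (-1) 2 (-3))) 0).
    move=> /cspectrum_plane[->|[x [y [xy E1 E2]]]]; [by right|left].
    (* The 2 x 2 system has rows (1, 2) and (-2, -3), with trace -2 and determinant 1. The
       combinations below eliminate one unknown as in Cramer's rule. *)
    suff /eqP : (l + 1) ^+ 2 = 0.
      by rewrite sqrf_eq0 addr_eq0 => /eqP -> /=; rewrite oppr_lt0.
    rewrite !rmorphN rmorph1 !rmorph_nat in E1 E2.
    have Ex : (l + 1) ^+ 2 * x = 0.
      transitivity (- 2 * (- 3 * y - 2 * x - l * y)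
                    - (3 + l) * (2 * y - - 1 * x - l * x)); first by ring.
      by rewrite E1 E2 !subrr !mulr0 subrr.
    have Ey : (l + 1) ^+ 2 * y = 0.
      transitivity ((1 - l) * (- 3 * y - 2 * x - l * y)
                    + 2 * (2 * y - - 1 * x - l * x)); first by ring.
      by rewrite E1 E2 !subrr !mulr0 addr0.
    case: xy => v0.
      by move/eqP: Ex; rewrite mulf_eq0 (negPf v0) orbF => /eqP.
    by move/eqP: Ey; rewrite mulf_eq0 (negPf v0) orbF => /eqP.
  exists beta => // alpha /[dup] /andP[a0 _] /Hb st.
  by apply/(gda_stableP _ _ _ _ _ _ (dg 0) (lt0r_neq0 a0) cz).
- split.
    move=> f L alpha z [_ dg _] L0 lip /[dup] /andP[a0 _] aL st.
    (* A fixed point satisfies alpha grad f D = 0, with alpha non-zero and D invertible. *)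
    have cz : critical_point f z.
      have [+ _] := st; rewrite gdaE => /(congr1 (fun w => w - z)).
      rewrite subrr addrAC subrr add0r => /eqP.
      rewrite scaler_eq0 gt_eqF//= => /eqP /(congr1 (mulmx^~ (flip_mx R n m))).
      by rewrite -mulmxA flip_mxK mulmx1 mul0mx.
    apply: (ogda_stable_of_Re_le0 _ _ _ _ _ _ _ (dg z) L0 lip aL cz).
    exact: (gda_stable_Re_le0 _ _ _ _ _ _ (dg z) a0 cz st).
  case: n n_gt0 => // n' _; case: m m_gt0 => // m' _.
  have Qs := tr_plane_mx R n' m' 0 1 0.
  have f2 := twice_cont_diff_quadratic _ _ _ Qs; have [_ dg _] := f2.
  have cz := critical_point_quadratic _ _ _ Qs.
  have [L L0 lip] := grad_lipschitz_quadratic _ _ _ Qs.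
  exists (quadratic _ (plane_mx R n' m' 0 1 0)), L, 0; split=> //; split=> //.
  (* The range in which the OGDA criterion applies; GDA fails for every non-zero stepsize. *)
  exists (1 / (2 * L)); first by rewrite divr_gt0// mulr_gt0.
  move=> alpha aL; split.
    apply: (ogda_stable_of_Re_le0 _ _ _ _ _ _ _ (dg 0) L0 lip aL cz).
    exact: saddle_Re_le0.
  by case/andP: aL => a0 _; apply: saddle_not_gda_stable; rewrite gt_eqF.
Qed.
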